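(* Let $(\Omega,\mathcal F)$ be a measurable space and let $\mathcal P,\mathcal Q\subset\mathcal M_1$ be nonempty. Then $$1-R(\mathcal P,\mathcal Q)=\sup_{\pi\in\Pi}\ \min_{p\in C_\pi,\ q\in D_\pi}\tfrac12\|p-q\|_1.$$ Consequently, for every $\varepsilon\ge0$, one has $R(\mathcal P,\mathcal Q)<1-\varepsilon$ if and only if there is a finite measurable partition $\pi\in\Pi$ with $\mathrm d_{\mathrm{TV}}(C_\pi,D_\pi)>\varepsilon$. In that event, there is a test $\phi$ with $R(\phi,\mathcal P,\mathcal Q)<1-\varepsilon$ that is constant on each of the sets of $\pi$.
   Context: $\mathcal M_1$ is the set of all countably additive probability measures on $(\Omega,\mathcal F)$. A test is an $\mathcal F$-measurable function $\phi:\Omega\to[0,1]$; $\Phi$ is the set of all tests. The risk of a test is $R(\phi,\mathcal P,\mathcal Q)=\sup_{\mu\in\mathcal P}\mathbb E_\mu[\phi]+\sup_{\nu\in\mathcal Q}\mathbb E_\nu[1-\phi]$ and the minimax risk is $R(\mathcal P,\mathcal Q)=\inf_{\phi\in\Phi}R(\phi,\mathcal P,\mathcal Q)$. $\Pi$ is the set of all partitions $\pi=\{A_1,\dots,A_k\}$ of $\Omega$ into finitely many nonempty measurable sets. For a measure $\mu$ and $\pi=\{A_1,\dots,A_k\}$, $\mu_\pi=(\mu(A_1),\dots,\mu(A_k))\in\mathbb R^k$. With $\mathrm{co}$ denoting the convex hull and $\mathrm{cl}$ the Euclidean closure, $C_\pi=\mathrm{cl}\{\mu_\pi:\mu\in\mathrm{co}(\mathcal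 P)\}$ and $D_\pi=\mathrm{cl}\{\nu_\pi:\nu\in\mathrm{co}(\mathcal Q)\}$, subsets of the probability simplex in $\mathbb R^{k}$. $\|\cdot\|_1$ is the $\ell^1$ norm and $\mathrm d_{\mathrm{TV}}(C_\pi,D_\pi)=\inf_{p\in C_\pi,q\in D_\pi}\tfrac12\|p-q\|_1$. *)

(* Defs.v *)
From HB Require Import structures.
From mathcomp Require Import all_boot all_order all_algebra.
From mathcomp Require Import all_classical all_reals all_analysis.

Set Implicit Arguments.
Unset Strict Implicit.
Unset Printing Implicit Defensive.

Import Order.TTheory GRing.Theory Num.Theory.
Import numFieldNormedType.Exports.

Local Open Scope classical_set_scope.
Local Open Scope ring_scope.

Definition is_test (R : realType) (d : measure_display) (T : measurableType d)
    (phi : T -> R) : Prop :=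
  measurable_fun setT phi /\ forall x, 0 <= phi x <= 1.

Definition risk (R : realType) (d : measure_display) (T : measurableType d)
    (phi : T -> R) (P Q : set (probability T R)) : \bar R :=
  (ereal_sup [set 'E_mu[phi] | mu in P] +
   ereal_sup [set 'E_nu[fun x => (1 - phi x)%R] | nu in Q])%E.

Definition minimax_risk (R : realType) (d : measure_display)
    (T : measurableType d) (P Q : set (probability T R)) : \bar R :=
  ereal_inf [set risk phi P Q | phi in [set phi | is_test phi]].

(* The blocks are listed in a chosen order; nonemptiness and disjointness, both
   part of [partition], make the enumeration free of repetitions. *)
Record fin_partition (d : measure_display) (T : measurableType d) :=
  FinPartition {
    nblocks : nat ;
    block : 'I_nblocks -> set T ;
    block_measurable : forall i, measurable (block i) ;
    block_partition : partition setT block setT }.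
Arguments block {d T} pi i : rename.

Definition proj_measure (R : realType) (d : measure_display)
    (T : measurableType d) (pi : fin_partition T) (mu : probability T R) :
    'rV[R]_(nblocks pi) :=
  \row_i fine (mu (block pi i)).
Arguments proj_measure {R d T} pi mu.

(* Equality of measures is required on measurable sets only: the values of a
   [measure] elsewhere carry no information. *)
Definition convex_hull (R : realType) (d : measure_display)
    (T : measurableType d) (P : set (probability T R)) :
    set (probability T R) :=
  [set mu : probability T R | exists (n : nat) (w : 'I_n -> R)
       (ms : 'I_n -> probability T R),
     [/\ forall i, 0 <= w i,
         \sum_i w i = 1,
         forall i, P (ms i) &
         forall A, measurable A ->
           mu A = (\sum_i (w i)%:E * ms i A)%E]].

(* The topology of 'rV_k is that of the sup norm, i.e. the Euclidean one. *)
Definition proj_closure (R : realType) (d : measure_display)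
    (T : measurableType d) (pi : fin_partition T)
    (P : set (probability T R)) : set 'rV[R]_(nblocks pi) :=
  closure [set proj_measure pi mu | mu in convex_hull P].
Arguments proj_closure {R d T} pi P.

Definition l1norm (R : realType) (k : nat) (v : 'rV[R]_k) : R :=
  \sum_i `|v ord0 i|.

Definition dTV (R : realType) (k : nat) (C D : set 'rV[R]_k) : \bar R :=
  ereal_inf [set (2^-1 * l1norm (p - q))%:E | p in C & q in D].

(* Main.v *)
(* For a finite partition, tests constant on its blocks are the vectors [c] of
   [0, 1]^k, and their risk is a supremum of [<c, p> + <1 - c, q>], that is of
   [1 - <c, q - p>], over [C_pi] and [D_pi].  When the total variation distance
   exceeds [s], the compact convex set [D_pi - C_pi] misses the l1-ball of
   radius [2 s]; a separating functional [u] of sup norm 1 gives the weights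
   [c = (1 + u) / 2], whose test has risk at most [1 - s].  Conversely, a test is
   within [e] of a step function on its level sets, and the closed half-spaces
   that bound the expectations over P and Q also contain [C_pi] and [D_pi], so
   the distance on that partition is at least [1 - risk - e]. *)
Require Import Defs.
From HB Require Import structures.
From mathcomp Require Import all_boot all_order all_algebra.
From mathcomp Require Import all_classical all_reals all_analysis.
From mathcomp Require Import measurable_realfun.
From mathcomp Require Import ring lra.

Set Implicit Arguments.
Unset Strict Implicit.
Unset Printing Implicit Defensive.

Import Order.TTheory GRing.Theory Num.Theory.
Import numFieldNormedType.Exports.

Local Open Scope classical_set_scope.
Local Open Scope ring_scope.

(** * Continuity, closed half-spaces and compact l1-balls in ['rV_k] *)

Lemma continuous_sum_ord (R : realType) (U : topologicalType) (k : nat)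
    (f : 'I_k -> U -> R) :
  (forall i, continuous (f i)) -> continuous (fun x => \sum_i f i x).
Proof.
move=> cf x.
have -> : (fun x => \sum_i f i x) = \sum_i f i.
  by apply/funext => y; rewrite fct_sumE.
elim/big_ind: _ => [|g h cg ch|i _]; first exact: cvg_cst.
  exact: cvgD.
exact: cf.
Qed.

Lemma closure_subset_closed (U : topologicalType) (A F : set U) :
  closed F -> A `<=` F -> closure A `<=` F.
Proof. by move=> /closure_id F_eq AF; rewrite F_eq; exact: closure_subset. Qed.

Lemma closed_sublevel (R : realType) (U : topologicalType) (f : U -> R) (a : R) :
  continuous f -> closed [set x | f x <= a].
Proof.
by move=> cf; apply: (@closed_comp _ _ f [set y | y <= a]).
Qed.

Lemma continuous_dot (R : realType) (k : nat) (c : 'I_k -> R) :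
  continuous (fun p : 'rV[R]_k => \sum_i c i * p ord0 i).
Proof.
apply: continuous_sum_ord => i p.
exact: (cvgMl_tmp (@coord_continuous R 1 k ord0 i p)).
Qed.

Lemma continuous_l1norm (R : realType) (k : nat) : continuous (@l1norm R k).
Proof.
apply: continuous_sum_ord => i p.
exact: (cvg_norm (@coord_continuous R 1 k ord0 i p)).
Qed.

Lemma closure_dot_le (R : realType) (k : nat) (A : set 'rV[R]_k)
    (c : 'I_k -> R) (a : R) :
  (forall p, A p -> \sum_i c i * p ord0 i <= a) ->
  forall p, closure A p -> \sum_i c i * p ord0 i <= a.
Proof.
by move=> Aa; apply: closure_subset_closed => //; apply: closed_sublevel;
   exact: continuous_dot.
Qed.

Lemma l1norm_coord_le (R : realType) (k : nat) (v : 'rV[R]_k) i :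
  `|v ord0 i| <= l1norm v.
Proof. by rewrite /l1norm (bigD1 i)//= lerDl sumr_ge0. Qed.

Lemma compact_l1_ball (R : realType) (k : nat) (r : R) :
  compact [set v : 'rV[R]_k | l1norm v <= r].
Proof.
apply: (@subclosed_compact _ _
  [set v : 'rV[R]_k | forall i, `[- r, r]%classic (v ord0 i)]).
- by apply: closed_sublevel; exact: continuous_l1norm.
- by apply: (@rV_compact _ _ (fun=> `[- r, r]%classic)) => i;
     exact: segment_compact.
- move=> v /= vr i; rewrite in_itv/= -ler_norml.
  exact: le_trans (l1norm_coord_le _ _) vr.
Qed.

(** * Convex sets and separation from an l1-ball *)

Definition convex_rV (R : realType) (k : nat) (C : set 'rV[R]_k) : Prop :=
  forall (t : R) p q, 0 <= t <= 1 -> C p -> C q -> C ((1 - t) *: p + t *: q).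

(** One endpoint is moved at a time: preimages of [closure C] under the affine maps [a + r *: x] are
    closed, so it suffices to take first [q], then [p], in [C] itself. *)
Lemma convex_closure (R : realType) (k : nat) (C : set 'rV[R]_k) :
  convex_rV C -> convex_rV (closure C).
Proof.
move=> cC t p q t01 Cp Cq.
have cD (a : 'rV[R]_k) (r : R) : continuous (fun x : 'rV[R]_k => a + r *: x).
  move=> x.
  exact: (cvgD (cvg_cst a) (@scaler_continuous R 'rV[R]_k r x)).
have pre (a : 'rV[R]_k) (r : R) :
    closed ((fun x : 'rV[R]_k => a + r *: x) @^-1` closure C).
  by apply: closed_comp => [x _|]; [exact: cD | exact: closed_closure].
apply: (@closure_subset_closed _ C _ (pre _ t) _ q Cq) => q' Cq' /=.
rewrite addrC.
apply: (@closure_subset_closed _ C _ (pre _ (1 - t)) _ p Cp) => p' Cp' /=.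
by rewrite addrC; apply: subset_closure; exact: cC.
Qed.

(** First-order condition at an endpoint minimum: [2 * a] is the slope at [0] of the quadratic. It
    yields the variational inequality for a vector of least norm. *)
Lemma ge0_slope (R : realType) (a b : R) :
  (forall t, 0 <= t <= 1 -> 0 <= 2 * t * a + t ^+ 2 * b) -> 0 <= b -> 0 <= a.
Proof.
move=> H b0; rewrite leNgt; apply/negP => a0.
have b1 : 0 < b + 1 by lra.
have b1a : 0 < - a / (b + 1) by rewrite divr_gt0//; lra.
(* If [a < 0], this [t] gives [2 * a + t * b <= a - t < 0]. The denominator [b + 1] stays positive
   when [b = 0]. *)
pose t := Num.min 1 (- a / (b + 1)).
have t0 : 0 < t by rewrite /t lt_min ltr01.
have t1 : t <= 1 by rewrite /t ge_min lexx.
have tb : t * (b + 1) <= - a by rewrite -ler_pdivlMr// /t ge_min lexx orbT.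
have /H : 0 <= t <= 1 by rewrite t1 ltW.
have -> : 2 * t * a + t ^+ 2 * b = t * (2 * a + t * b) by ring.
rewrite pmulr_rge0//; nra.
Qed.

Lemma convex_l1_ball (R : realType) (k : nat) (r : R) :
  convex_rV [set v : 'rV[R]_k | l1norm v <= r].
Proof.
move=> t p q /andP[t0 t1] /= pr qr.
apply: (@le_trans _ _ ((1 - t) * l1norm p + t * l1norm q)).
  rewrite /l1norm !mulr_sumr -big_split/= ler_sum// => i _.
  by rewrite !mxE (le_trans (ler_normD _ _))// !normrM
    (ger0_norm t0) ger0_norm// subr_ge0.
nra.
Qed.

(* The normal is the vector of least Euclidean norm of [D - C - B], where [B] is
   the l1-ball of radius [r]; its support function on [B] is [r] times its sup
   norm. *)
Lemma l1_separation (R : realType) (k : nat) (C D : set 'rV[R]_k) (r : R) :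
  0 <= r -> C !=set0 -> D !=set0 -> compact C -> compact D ->
  convex_rV C -> convex_rV D ->
  (forall p q, C p -> D q -> r < l1norm (p - q)) ->
  exists u : 'I_k -> R, (forall i, `|u i| <= 1) /\
    forall p q, C p -> D q -> r <= \sum_i u i * (q ord0 i - p ord0 i).
Proof.
move=> r0 [p1 Cp1] [q1 Dq1] coC coD cvC cvD far.
pose B := [set v : 'rV[R]_k | l1norm v <= r].
(* Minimising over triples [(p, q, w)] in the compact product [C * D * B] avoids forming the set of
   differences. *)
pose f (x : 'rV[R]_k * 'rV[R]_k * 'rV[R]_k) :=
  \sum_i (x.1.2 ord0 i - x.1.1 ord0 i - x.2 ord0 i) ^+ 2.
have cf : continuous f.
  apply: continuous_sum_ord => i x.
  have c1 : (fun y : 'rV[R]_k * 'rV[R]_k * 'rV[R]_k =>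
      y.1.2 ord0 i - y.1.1 ord0 i - y.2 ord0 i) y @[y --> x] -->
      x.1.2 ord0 i - x.1.1 ord0 i - x.2 ord0 i.
    have cc (g : 'rV[R]_k * 'rV[R]_k * 'rV[R]_k -> 'rV[R]_k) :
        {for x, continuous g} -> (g y) ord0 i @[y --> x] --> (g x) ord0 i.
      move=> cg.
      exact: (continuous_comp cg (@coord_continuous R 1 k ord0 i (g x))).
    apply: (cvgB (cvgB (cc (snd \o fst) _) (cc (fst \o fst) _)) (cc snd _)).
    - by apply: continuous_comp; [exact: cvg_fst | exact: cvg_snd].
    - by apply: continuous_comp; [exact: cvg_fst | exact: cvg_fst].
    - exact: cvg_snd.
  exact: (cvgM c1 c1).
have l0 : B 0.
  by rewrite /B/= /l1norm big1// => i _; rewrite mxE normr0.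
have [|||[[p0 q0] w0]] := @compact_EVT_min _ R f (C `*` D `*` B).
- by exists (p1, q1, 0).
- by apply: compact_setX; [exact: compact_setX | exact: compact_l1_ball].
- by apply: continuous_subspaceT.
rewrite inE => -[[/= Cp0 Dq0] Bw0] fmin.
pose u i := q0 ord0 i - p0 ord0 i - w0 ord0 i.
pose U := \sum_i u i ^+ 2.
have U0 : 0 <= U by apply: sumr_ge0 => i _; exact: sqr_ge0.
(* Variational inequality: moving from the minimiser towards [(p, q, w)] along a segment changes [f]
   by [2 * t * a + t ^+ 2 * b], where [a] is the inner product of [u] with the displacement and [b]
   the squared norm of that displacement. *)
have Umin p q w : C p -> D q -> B w ->
    U <= \sum_i u i * (q ord0 i - p ord0 i - w ord0 i).
  move=> Cp Dq Bw; rewrite -subr_ge0 /U -sumrB.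
  under eq_bigr do rewrite expr2 -mulrBr.
  apply: (@ge0_slope _ _ (\sum_i (q ord0 i - p ord0 i - w ord0 i - u i) ^+ 2)).
    move=> t t01.
    have /fmin : ((1 - t) *: p0 + t *: p, (1 - t) *: q0 + t *: q,
        (1 - t) *: w0 + t *: w) \in C `*` D `*` B.
      rewrite inE; split; [split => /=; [exact: cvC | exact: cvD] | ].
      exact: convex_l1_ball.
    rewrite -subr_ge0 /f/= -sumrB; congr (0 <= _).
    rewrite !mulr_sumr -big_split/=; apply: eq_bigr => i _.
    by rewrite !mxE /u; ring.
  by apply: sumr_ge0 => i _; exact: sqr_ge0.
(* Otherwise [q0 - p0 = w0] lies in the ball, against [far]. *)
have [i0 ui0] : exists i, u i != 0.
  apply: contrapT => /forallNP u0.
  have /(far _ _ Cp0) : D q0 by [].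
  suff -> : l1norm (p0 - q0) = l1norm w0 by rewrite ltNge Bw0.
  rewrite /l1norm; apply: eq_bigr => i _.
  have := u0 i; move/negP; rewrite negbK /u subr_eq0 => /eqP <-.
  by rewrite !mxE distrC.
have Upos : 0 < U.
  rewrite /U (bigD1 i0)//= ltr_pwDl//.
    by rewrite exprn_even_gt0.
  by apply: sumr_ge0 => i _; exact: sqr_ge0.
(* Dividing by the largest [|u m|] makes the sup norm equal to 1. *)
have [m _ mmax] := @Order.TotalTheory.arg_maxP _ _ _ i0 xpredT (fun i => `|u i|) isT.
have M0 : 0 < `|u m|.
  by apply: lt_le_trans (mmax i0 isT); rewrite normr_gt0.
exists (fun i => u i / `|u m|); split.
  move=> i; rewrite normrM normfV normr_id ler_pdivrMr// mul1r; exact: mmax.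
move=> p q Cp Dq.
under eq_bigr do rewrite mulrAC.
rewrite -mulr_suml ler_pdivlMr//.
(* The vertex of the ball where [u] is maximal: its pairing with [u] is [r * |u m|], so [Umin] and
   [U >= 0] give the bound. *)
pose w : 'rV[R]_k := \row_i (if i == m then r * Num.sg (u m) else 0).
have Bw : B w.
  rewrite /B/= /l1norm (bigD1 m)//= big1 => [|i /negPf im].
    by rewrite mxE eqxx addr0 normrM normr_sg ger0_norm// -normr_gt0 M0 mulr1.
  by rewrite mxE im normr0.
have := Umin _ _ _ Cp Dq Bw.
under eq_bigr do rewrite mulrBr.
rewrite sumrB => H.
have E : \sum_i u i * w ord0 i = r * `|u m|.
  rewrite (bigD1 m)//= big1 => [|i /negPf im]; last by rewrite mxE im mulr0.
  by rewrite mxE eqxx addr0 normrEsg; ring.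
move: H; rewrite E; lra.
Qed.

(** With [c = (1 + u) / 2] and coordinates summing to 1, the left side is [1] minus half the pairing
    of [u] with [q - p]; separation at radius [2 * s] bounds that pairing below. *)
Lemma l1_separating_weights (R : realType) (k : nat) (C D : set 'rV[R]_k) (s : R) :
  C !=set0 -> D !=set0 -> compact C -> compact D ->
  convex_rV C -> convex_rV D ->
  (forall p, C p -> \sum_i p ord0 i = 1) ->
  (forall p, D p -> \sum_i p ord0 i = 1) ->
  (forall p q, C p -> D q -> s < 2^-1 * l1norm (p - q)) ->
  exists c : 'I_k -> R, (forall i, 0 <= c i <= 1) /\
    forall p q, C p -> D q ->
      \sum_i c i * p ord0 i + \sum_i (1 - c i) * q ord0 i <= 1 - s.
Proof.
move=> C0 D0 coC coD cvC cvD C1 D1 far.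
have [s0|s0] := ltP s 0.
  (* For [s < 0] the ball is empty, and the zero weights already give the value [1 <= 1 - s]. *)
  exists (fun=> 0); split=> [i|p q Cp Dq]; first by rewrite lexx ler01.
  rewrite big1 => [|i _]; last by rewrite mul0r.
  under eq_bigr do rewrite subr0 mul1r.
  by rewrite D1//; lra.
have [||u [u1 sep]] := @l1_separation R k C D (2 * s) _ C0 D0 coC coD cvC cvD.
- by rewrite mulr_ge0.
- by move=> p q Cp Dq; have := far _ _ Cp Dq; lra.
exists (fun i => 2^-1 * (1 + u i)); split.
  by move=> i; have := u1 i; rewrite ler_norml; lra.
move=> p q Cp Dq.
have -> : \sum_i 2^-1 * (1 + u i) * p ord0 i +
    \sum_i (1 - 2^-1 * (1 + u i)) * q ord0 i =
    2^-1 * \sum_i p ord0 i + 2^-1 * \sum_i q ord0 i -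
    2^-1 * \sum_i u i * (q ord0 i - p ord0 i).
  rewrite !mulr_sumr -!big_split/= -sumrB; apply: eq_bigr => i _; lra.
have := sep _ _ Cp Dq; rewrite C1// D1//; lra.
Qed.

(** * Step functions on a finite partition and their expectations *)

Section partition_tests.
Context (R : realType) (d : measure_display) (T : measurableType d).
Implicit Types (pi : fin_partition T) (mu nu : probability T R).
Implicit Types (P Q : set (probability T R)).

Definition step_fun pi (c : 'I_(nblocks pi) -> R) (x : T) : R :=
  \sum_i c i * \1_(block pi i) x.

Lemma block_cover pi x : exists i, block pi i x.
Proof.
have [cov _ _] := block_partition pi.
have : [set: T] x by [].
by rewrite -cov => -[i _ xi]; exists i.
Qed.

Lemma step_funE pi (c : 'I_(nblocks pi) -> R) i x :
  block pi i x -> step_fun c x = c i.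
Proof.
move=> xi; have [_ triv _] := block_partition pi.
rewrite /step_fun (bigD1 i)//= indicE mem_set// mulr1 big1 ?addr0// => j ji.
rewrite indicE memNset ?mulr0// => xj; move/eqP: ji; apply.
by apply: (triv j i) => //; exists x.
Qed.

Lemma step_fun_cst pi (a : R) x : @step_fun pi (fun=> a) x = a.
Proof. by have [i xi] := block_cover pi x; rewrite (step_funE _ xi). Qed.

Lemma step_fun_onem pi (c : 'I_(nblocks pi) -> R) x :
  1 - step_fun c x = step_fun (fun i => 1 - c i) x.
Proof. by have [i xi] := block_cover pi x; rewrite !(step_funE _ xi). Qed.

Lemma step_fun_ge0 pi (c : 'I_(nblocks pi) -> R) x :
  (forall i, 0 <= c i) -> 0 <= step_fun c x.
Proof. by move=> c0; have [i xi] := block_cover pi x; rewrite (step_funE _ xi). Qed.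

Lemma measurable_step_fun pi (c : 'I_(nblocks pi) -> R) :
  measurable_fun setT (step_fun c).
Proof.
apply: measurable_sum => i; apply: measurable_funM => //.
by apply: measurable_indic; exact: block_measurable.
Qed.

Lemma is_test_step_fun pi (c : 'I_(nblocks pi) -> R) :
  (forall i, 0 <= c i <= 1) -> is_test (step_fun c).
Proof.
move=> c01; split; first exact: measurable_step_fun.
by move=> x; have [i xi] := block_cover pi x; rewrite (step_funE _ xi).
Qed.

(** Nonnegative coefficients allow the sum to leave the integral by additivity for nonnegative
    functions, without integrability arguments. *)
Lemma expectation_step_fun pi (c : 'I_(nblocks pi) -> R) mu :
  (forall i, 0 <= c i) ->
  ('E_mu[step_fun c])%E = (\sum_i c i * proj_measure pi mu ord0 i)%:E.
Proof.
move=> c0; rewrite unlock.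
under eq_integral do rewrite /step_fun -sumEFin.
rewrite ge0_integral_sum//=; last first.
- by move=> i x _; rewrite lee_fin mulr_ge0.
- move=> i; apply/measurable_EFinP; apply: measurable_funM => //.
  by apply: measurable_indic; exact: block_measurable.
rewrite -sumEFin; apply: eq_bigr => i _.
have mi := block_measurable i.
under eq_integral do rewrite EFinM.
rewrite ge0_integralZl_EFin//=; last first.
  by apply/measurable_EFinP; exact: measurable_indic.
rewrite integral_indic// setIT EFinM mxE fineK// fin_num_measure//.
Qed.

(** * The projected sets: compactness, convexity and attainment of the distance *)

Lemma sum_proj_measure pi mu : \sum_i proj_measure pi mu ord0 i = 1.
Proof.
apply: EFin_inj; rewrite -(expectation_cst mu 1).
(* The constant 1 is a step function on [pi], so its expectation is the sum of the block masses. *)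
rewrite -[X in ('E_ _[X])%E](_ : @step_fun pi (fun=> 1) = _).
  rewrite expectation_step_fun//; congr (_%:E).
  by apply: eq_bigr => i _; rewrite mul1r.
by apply/funext => x; rewrite step_fun_cst.
Qed.

Lemma proj_measure_ge0 pi mu i : 0 <= proj_measure pi mu ord0 i.
Proof. by rewrite mxE fine_ge0. Qed.

Lemma l1norm_proj_measure pi mu : l1norm (proj_measure pi mu) = 1.
Proof.
rewrite /l1norm -(sum_proj_measure pi mu); apply: eq_bigr => i _.
by rewrite ger0_norm// proj_measure_ge0.
Qed.

Lemma compact_proj_closure pi P : compact (proj_closure pi P).
Proof.
apply: (@subclosed_compact _ _ [set v | l1norm v <= 1]).
- exact: closed_closure.
- exact: compact_l1_ball.
- apply: closure_subset_closed; first exact/closed_sublevel/continuous_l1norm.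
  by move=> _ [mu _ <-] /=; rewrite l1norm_proj_measure.
Qed.

Lemma sum_proj_closure pi P p :
  proj_closure pi P p -> \sum_i p ord0 i = 1.
Proof.
move=> Pp.
(* The hyperplane of coordinate sum 1 is cut out by two closed half-spaces, with coefficients [1]
   and [-1]. *)
have le1 : \sum_i 1 * p ord0 i <= 1.
  apply: (closure_dot_le (c := fun=> 1)) Pp => _ [mu _ <-].
  by under eq_bigr do rewrite mul1r; rewrite sum_proj_measure.
have ge1 : \sum_i (-1) * p ord0 i <= -1.
  apply: (closure_dot_le (c := fun=> -1)) Pp => _ [mu _ <-].
  by rewrite -mulr_sumr sum_proj_measure mulr1.
apply/eqP; rewrite eq_le; apply/andP; split.
  by move: le1; rewrite -mulr_sumr mul1r.
by move: ge1; rewrite -mulr_sumr mulN1r lerN2.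
Qed.

Lemma sub_convex_hull P : P `<=` convex_hull P.
Proof.
move=> mu Pmu; exists 1%N, (fun=> 1), (fun=> mu); split => //.
  by rewrite big_ord1.
by move=> A mA; rewrite big_ord1 mul1e.
Qed.

Lemma proj_closure_mem pi P mu : P mu -> proj_closure pi P (proj_measure pi mu).
Proof.
by move=> Pmu; apply: subset_closure; exists mu => //; exact: sub_convex_hull.
Qed.

Lemma exists_mixture (t : R) mu nu : 0 <= t <= 1 ->
  exists rho : probability T R, forall A,
    rho A = ((1 - t)%:E * mu A + t%:E * nu A)%E.
Proof.
move=> /andP[t0 t1].
have s0 : 0 <= 1 - t by rewrite subr_ge0.
pose m : {measure set T -> \bar R} :=
  measure_add (mscale (NngNum s0) mu) (mscale (NngNum t0) nu).
have mE A : m A = ((1 - t)%:E * mu A + t%:E * nu A)%E by exact: measure_addE.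
have m1 : m setT = 1%E by rewrite mE !probability_setT !mule1 -EFinD subrK.
(* Normalising only supplies the probability structure: [m] has mass 1, so its values do not change
   and the fallback [mu] is never taken. *)
exists (mnormalize m mu) => A.
by rewrite -mE /= /mnormalize m1 onee_eq0/= invr1 mule1.
Qed.

Lemma convex_proj_hull pi P :
  convex_rV [set proj_measure pi mu | mu in convex_hull P].
Proof.
move=> t _ _ t01 [mu [n [w [ms [w0 w1 msP muE]]]] <-]
  [nu [n' [w' [ms' [w'0 w'1 ms'P nuE]]]] <-].
have [rho rhoE] := exists_mixture mu nu t01.
have /andP[t0 t1] := t01.
exists rho; last first.
  apply/rowP => i; rewrite !mxE rhoE fineD ?fin_numM ?fin_num_measure//;
    try exact: block_measurable.
  by rewrite !fineM// fin_num_measure//; exact: block_measurable.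
(* The two convex combinations are concatenated, with weights scaled by [1 - t] and [t]. *)
exists (n + n')%N,
  (fun i => match fintype.split i with inl j => (1 - t) * w j | inr j => t * w' j end),
  (fun i => match fintype.split i with inl j => ms j | inr j => ms' j end).
split.
- by move=> i; case: (fintype.split i) => j; rewrite mulr_ge0// subr_ge0.
- rewrite big_split_ord/=.
  under eq_bigr do rewrite (unsplitK (inl _)).
  under [X in _ + X]eq_bigr do rewrite (unsplitK (inr _)).
  by rewrite -!mulr_sumr w1 w'1 !mulr1 subrK.
- by move=> i; case: (fintype.split i) => j.
- move=> A mA; rewrite rhoE muE// nuE// big_split_ord/=.
  under [in RHS]eq_bigr do rewrite (unsplitK (inl _)).
  under [X in _ = (_ + X)%E]eq_bigr do rewrite (unsplitK (inr _)).
  rewrite !ge0_sume_distrr; first last.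
  + by move=> i _; rewrite mule_ge0// lee_fin.
  + by move=> i _; rewrite mule_ge0// lee_fin.
  by congr (_ + _)%E; apply: eq_bigr => i _; rewrite EFinM muleA.
Qed.

Lemma convex_proj_closure pi P : convex_rV (proj_closure pi P).
Proof. exact/convex_closure/convex_proj_hull. Qed.

(** A linear bound on [P] passes to the convex hull by averaging and to the closure because a
    half-space is closed. *)
Lemma proj_closure_dot_le pi P (c : 'I_(nblocks pi) -> R) (a : R) :
  (forall mu, P mu -> \sum_i c i * proj_measure pi mu ord0 i <= a) ->
  forall p, proj_closure pi P p -> \sum_i c i * p ord0 i <= a.
Proof.
move=> Pa; apply: closure_dot_le => _ [mu [n [w [ms [w0 w1 msP muE]]]] <-].
have projE i :
    proj_measure pi mu ord0 i = \sum_j w j * proj_measure pi (ms j) ord0 i.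
  apply: EFin_inj; rewrite mxE fineK ?fin_num_measure//; last first.
    exact: block_measurable.
  rewrite muE; last exact: block_measurable.
  rewrite -sumEFin; apply: eq_bigr => j _.
  by rewrite mxE EFinM fineK ?fin_num_measure//; exact: block_measurable.
under eq_bigr do rewrite projE mulr_sumr.
rewrite exchange_big/= -[a]mul1r -w1 mulr_suml ler_sum// => j _.
under eq_bigr do rewrite mulrCA.
by rewrite -mulr_sumr ler_wpM2l// Pa.
Qed.

(** A continuous function on a compact product attains its minimum. Besides justifying the minimum,
    this makes [dTV] a real number in later computations. *)
Lemma dTV_attained pi P Q : P !=set0 -> Q !=set0 ->
  exists p q, [/\ proj_closure pi P p, proj_closure pi Q q &
    dTV (proj_closure pi P) (proj_closure pi Q) = (2^-1 * l1norm (p - q))%:E].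
Proof.
move=> [mu Pmu] [nu Qnu].
pose C := proj_closure pi P; pose D := proj_closure pi Q.
have [|||[p q]] := @compact_EVT_min _ R
    (fun x : 'rV[R]_(nblocks pi) * 'rV[R]_(nblocks pi) => l1norm (x.1 - x.2))
    (C `*` D).
- by exists (proj_measure pi mu, proj_measure pi nu);
     split; exact: proj_closure_mem.
- by apply: compact_setX; exact: compact_proj_closure.
- apply: continuous_subspaceT => x.
  apply: (@continuous_comp _ _ _
    (fun x : 'rV[R]_(nblocks pi) * 'rV[R]_(nblocks pi) => x.1 - x.2)).
    exact: (cvgB (@cvg_fst _ _ _ _ _) (@cvg_snd _ _ _ _ _)).
  exact: continuous_l1norm.
rewrite inE => -[/= Cp Dq] pqmin.
exists p, q; split => //; apply/eqP; rewrite eq_le; apply/andP; split.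
  by apply: ereal_inf_lbound; exists p => //; exists q.
apply: le_ereal_inf_tmp => _ [p' Cp' [q' Dq' <-]].
rewrite lee_fin ler_wpM2l ?invr_ge0//.
by apply: (pqmin (p', q')); rewrite inE.
Qed.

(** * From separated projections to a step test *)

Lemma ereal_sup_add_le (A B : set (\bar R)) (r : R) :
  A !=set0 -> B !=set0 -> (forall x, A x -> x \is a fin_num) -> (forall y, B y -> y \is a fin_num) ->
  (forall x y, A x -> B y -> (x + y <= r%:E)%E) ->
  (ereal_sup A + ereal_sup B <= r%:E)%E.
Proof.
move=> [a Aa] [b Bb] fA fB H.
have B_le x : A x -> (ereal_sup B <= r%:E - x)%E.
  move=> Ax; apply: ge_ereal_sup => y By; rewrite leeBrDl ?fA//.
  exact: H.
(* The supremum lies between [b] and [r - a]; finiteness is what permits moving it across the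
   inequality in [\bar R]. *)
have fB' : ereal_sup B \is a fin_num.
  have := B_le _ Aa; have := ereal_sup_ubound Bb.
  have := fA _ Aa; have := fB _ Bb.
  by case: a {Aa} => // a; case: b {Bb} => // b; case: (ereal_sup B).
rewrite -leeBrDr//; apply: ge_ereal_sup => x Ax.
rewrite leeBrDr// addeC -leeBrDr ?fA//; exact: B_le.
Qed.

Lemma risk_step_fun_le pi P Q (c : 'I_(nblocks pi) -> R) (r : R) :
  P !=set0 -> Q !=set0 -> (forall i, 0 <= c i <= 1) ->
  (forall p q, proj_closure pi P p -> proj_closure pi Q q ->
    \sum_i c i * p ord0 i + \sum_i (1 - c i) * q ord0 i <= r) ->
  (risk (step_fun c) P Q <= r%:E)%E.
Proof.
move=> [mu0 Pmu0] [nu0 Qnu0] c01 H.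
have c0 i : 0 <= c i by have /andP[] := c01 i.
have c1 i : 0 <= 1 - c i by rewrite subr_ge0; have /andP[] := c01 i.
have EQ nu : ('E_nu[fun x => (1 - step_fun c x)%R] =
    (\sum_i (1 - c i) * proj_measure pi nu ord0 i)%:E)%E.
  rewrite -expectation_step_fun//; congr ('E_nu[_])%E.
  by apply/funext => x; rewrite step_fun_onem.
apply: ereal_sup_add_le.
- by exists ('E_mu0[step_fun c])%E, mu0.
- by exists ('E_nu0[fun x => (1 - step_fun c x)%R])%E, nu0.
- by move=> _ [mu _ <-]; rewrite expectation_step_fun.
- by move=> _ [nu _ <-]; rewrite EQ.
- move=> _ _ [mu Pmu <-] [nu Qnu <-].
  by rewrite expectation_step_fun// EQ -EFinD lee_fin H//;
     exact: proj_closure_mem.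
Qed.

Lemma exists_test_of_dTV pi P Q (s : R) : P !=set0 -> Q !=set0 ->
  (s%:E < dTV (proj_closure pi P) (proj_closure pi Q))%E ->
  exists c : 'I_(nblocks pi) -> R,
    (forall i, 0 <= c i <= 1) /\ (risk (step_fun c) P Q <= (1 - s)%:E)%E.
Proof.
move=> P0 Q0 sdTV; have [[mu Pmu] [nu Qnu]] := (P0, Q0).
have [|||c [c01 sep]] := @l1_separating_weights R _
    (proj_closure pi P) (proj_closure pi Q) s _ _
    (@compact_proj_closure pi P) (@compact_proj_closure pi Q)
    (@convex_proj_closure pi P) (@convex_proj_closure pi Q)
    (@sum_proj_closure pi P) (@sum_proj_closure pi Q) _.
- by exists (proj_measure pi mu); exact: proj_closure_mem.
- by exists (proj_measure pi nu); exact: proj_closure_mem.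
- move=> p q Cp Dq; rewrite -lte_fin (lt_le_trans sdTV)//.
  by apply: ereal_inf_lbound; exists p => //; exists q.
- by exists c; split => //; exact: risk_step_fun_le.
Qed.

(** * Approximation of a test by a step function *)

Lemma exists_level_partition (m : nat) (f : T -> 'I_m) :
  (forall j, measurable (f @^-1` [set j])) ->
  exists (pi : fin_partition T) (g : 'I_(nblocks pi) -> 'I_m),
    forall i x, block pi i x -> f x = g i.
Proof.
(* Blocks must be nonempty, so only the values attained by [f] serve as indices. *)
move=> mf; pose J := [pred j : 'I_m | `[< exists x, f x = j >]].
pose b (i : 'I_#|J|) := f @^-1` [set enum_val i].
have bP : partition setT b setT.
  split.
  - apply/seteqP; split => // x _.
    have Jx : f x \in J by apply/asboolP; exists x.
    by exists (enum_rank_in Jx (f x)) => //; rewrite /b/= enum_rankK_in.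
  - move=> i j _ _ [x [/= xi xj]]; apply: enum_val_inj.
    by rewrite -xi -xj.
  - move=> i _; have /asboolP[x fx] := enum_valP i.
    by exists x.
exists (FinPartition (fun i => mf (enum_val i)) bP).
by exists (@enum_val _ J).
Qed.

(** Rounding [phi] down to a multiple of [1 / n], with [n > 1 / e], loses at most [e]; the blocks
    are the nonempty level sets of the rounded function. *)
Lemma step_fun_approx (phi : T -> R) (e : R) : is_test phi -> 0 < e ->
  exists (pi : fin_partition T) (c : 'I_(nblocks pi) -> R),
    (forall i, 0 <= c i <= 1) /\
    forall x, step_fun c x <= phi x <= step_fun c x + e.
Proof.
move=> [mphi phi01] e0; pose n := (Num.truncn e^-1).+1.
have n0 : 0 < n%:R :> R by rewrite ltr0n.
have ne : n%:R^-1 <= e.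
  by rewrite -[e]invrK lef_pV2 ?posrE ?invr_gt0// ltW// truncnS_gt.
have phin x : 0 <= phi x * n%:R <= n%:R.
  have /andP[h0 h1] := phi01 x.
  by rewrite mulr_ge0//= ger_pMl.
(* There are [n.+1] levels because [phi x = 1] rounds to [n]. *)
pose f x : 'I_n.+1 := inord (Num.truncn (phi x * n%:R)).
have fE x : f x = Num.truncn (phi x * n%:R) :> nat.
  rewrite inordK// ltnS.
  have /andP[_ h] := phin x.
  by rewrite -[leqRHS](@natrK R) le_truncn.
have [j|pi [g gE]] := @exists_level_partition _ f.
  have -> : f @^-1` [set j] =
      (fun x => phi x * n%:R) @^-1` `[j%:R, j.+1%:R[%classic.
    apply/seteqP; split => x /=; rewrite in_itv/=.
      move=> <-; rewrite fE; apply: truncn_itv.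
      by have /andP[] := phin x.
    by move=> h; apply/val_inj; rewrite /= fE; exact: truncn_def.
  rewrite -[X in measurable X]setTI.
  by apply: measurable_funM => //; exact: measurable_cst.
exists pi, (fun i => (g i)%:R / n%:R); split.
  move=> i; rewrite divr_ge0//= ler_pdivrMr// mul1r ler_nat.
  by rewrite -ltnS.
move=> x; have [i xi] := block_cover pi x; rewrite (step_funE _ xi).
rewrite -(gE _ _ xi) fE ler_pdivrMr//.
have /andP[/truncn_itv/andP[-> lt1] _] /= := phin x.
apply: (@le_trans _ _ ((Num.truncn (phi x * n%:R))%:R / n%:R + n%:R^-1)).
  by rewrite -[X in _ <= _ + X]mul1r -mulrDl ler_pdivlMr// natr1 ltW.
by rewrite lerD2l.
Qed.

(** * Finiteness of expectations and risks of tests *)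

Lemma expectation_test (phi : T -> R) mu : is_test phi ->
  (0 <= 'E_mu[phi] <= 1)%E.
Proof.
move=> [mphi phi01]; rewrite expectation_ge0/=; last first.
  by move=> x; have /andP[] := phi01 x.
rewrite -(expectation_cst mu 1); apply: expectation_le => //.
- by move=> x; have /andP[] := phi01 x.
- by apply: nearW => x; have /andP[] := phi01 x.
Qed.

Lemma Lfun1_test (phi : T -> R) mu : is_test phi -> phi \in Lfun mu 1.
Proof.
move=> [mphi phi01]; apply/Lfun1_integrable.
apply: measurable_bounded_integrable => //.
  by rewrite -ge0_fin_numE// fin_num_measure.
exists 1; split; first exact: num_real.
move=> M M1 x _; have /andP[h0 h1] := phi01 x.
by rewrite /= ger0_norm// (le_trans h1)// ltW.
Qed.

Lemma is_test_onem (phi : T -> R) : is_test phi -> is_test (fun x => 1 - phi x).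
Proof.
move=> [mphi phi01]; split; first exact: measurable_funB.
by move=> x; have /andP[h0 h1] := phi01 x; rewrite subr_ge0 h1 lerBlDr lerDl.
Qed.

Lemma ereal_sup_expectation_fin_num (phi : T -> R) P : P !=set0 -> is_test phi ->
  ereal_sup [set 'E_mu[phi]%E | mu in P] \is a fin_num.
Proof.
move=> [mu Pmu] tphi; apply/fin_numPlt; apply/andP; split.
  apply: (@lt_le_trans _ _ 'E_mu[phi]%E).
    by have /andP[h _] := expectation_test mu tphi; exact: lt_le_trans h.
  by apply: ereal_sup_ubound; exists mu.
apply: (@le_lt_trans _ _ 1%E); last by rewrite ltry.
apply: ge_ereal_sup => _ [nu _ <-].
by have /andP[] := expectation_test nu tphi.
Qed.

Lemma risk_fin_num (phi : T -> R) P Q : P !=set0 -> Q !=set0 -> is_test phi ->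
  risk phi P Q \is a fin_num.
Proof.
move=> P0 Q0 tphi; rewrite fin_numD !ereal_sup_expectation_fin_num//.
exact: is_test_onem.
Qed.

Lemma risk_ge0 (phi : T -> R) P Q : P !=set0 -> Q !=set0 -> is_test phi ->
  (0 <= risk phi P Q)%E.
Proof.
move=> [mu Pmu] [nu Qnu] tphi; apply: adde_ge0.
  apply: (@le_trans _ _ 'E_mu[phi]%E); last first.
    by apply: ereal_sup_ubound; exists mu.
  by have /andP[] := expectation_test mu tphi.
apply: (@le_trans _ _ ('E_nu[fun x => (1 - phi x)%R])%E); last first.
  by apply: ereal_sup_ubound; exists nu.
by have /andP[] := expectation_test nu (is_test_onem tphi).
Qed.

(** Replacing [phi] by its step approximation from below does not raise the first supremum and
    raises the second by at most [e]. Both bounds hold at a closest pair [p], [q], whose distance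
    dominates the pairing of [c] with [q - p]. *)
Lemma exists_partition_of_test (phi : T -> R) P Q (e : R) :
  P !=set0 -> Q !=set0 -> is_test phi -> 0 < e ->
  exists pi, (1 - risk phi P Q <=
    dTV (proj_closure pi P) (proj_closure pi Q) + e%:E)%E.
Proof.
move=> P0 Q0 tphi e0.
have [pi [c [c01 capprox]]] := step_fun_approx tphi e0.
have tc := is_test_step_fun c01.
have tphi' := is_test_onem tphi.
have c0 i : 0 <= c i by have /andP[] := c01 i.
have c1 i : 0 <= 1 - c i by rewrite subr_ge0; have /andP[] := c01 i.
exists pi.
pose a := fine (ereal_sup [set 'E_mu[phi]%E | mu in P]).
pose b := fine (ereal_sup [set 'E_nu[fun x => (1 - phi x)%R]%E | nu in Q]).
have aE : a%:E = ereal_sup [set 'E_mu[phi]%E | mu in P].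
  by rewrite fineK// ereal_sup_expectation_fin_num.
have bE : b%:E = ereal_sup [set 'E_nu[fun x => (1 - phi x)%R]%E | nu in Q].
  by rewrite fineK// ereal_sup_expectation_fin_num.
have Pa p : proj_closure pi P p -> \sum_i c i * p ord0 i <= a.
  apply: proj_closure_dot_le => mu Pmu.
  rewrite -lee_fin -expectation_step_fun// aE.
  apply: (@le_trans _ _ 'E_mu[phi]%E); last first.
    by apply: ereal_sup_ubound; exists mu.
  have [mphi phi01] := tphi; have [mc cc01] := tc.
  apply: expectation_le => //.
  - by move=> x; have /andP[] := cc01 x.
  - by move=> x; have /andP[] := phi01 x.
  - by apply: nearW => x; have /andP[] := capprox x.
have Qb q : proj_closure pi Q q -> \sum_i (1 - c i) * q ord0 i <= b + e.
  apply: proj_closure_dot_le => nu Qnu.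
  rewrite -lee_fin -expectation_step_fun//.
  have [mphi phi01] := tphi'.
  apply: (@le_trans _ _ ('E_nu[(fun x => (1 - phi x)%R) \+ cst e])%E).
    apply: expectation_le => //.
    - exact: measurable_step_fun.
    - by apply: measurable_funD => //; exact: measurable_cst.
    - by move=> x; exact: step_fun_ge0.
    - move=> x /=; apply: addr_ge0; last exact: ltW.
      by have /andP[] := phi01 x.
    - apply: nearW => x; rewrite -step_fun_onem /=.
      have /andP[_ h] := capprox x; lra.
  rewrite expectationD.
  - rewrite expectation_cst EFinD leeD2r// bE.
    by apply: ereal_sup_ubound; exists nu.
  - exact: Lfun1_test.
  - exact: Lfun_cst.
have riskE : risk phi P Q = (a + b)%:E by rewrite EFinD aE bE.
rewrite riskE -EFinB.
have [p [q [Cp Dq ->]]] := @dTV_attained pi P Q P0 Q0.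
rewrite -EFinD lee_fin.
(* Since [q - p] has coordinate sum 0, [c] may be replaced by [(2 * c - 1) / 2], whose entries have
   modulus at most [1 / 2]. *)
have diff : \sum_i c i * (q ord0 i - p ord0 i) <= 2^-1 * l1norm (p - q).
  have -> : \sum_i c i * (q ord0 i - p ord0 i) =
      2^-1 * \sum_i (2 * c i - 1) * (q ord0 i - p ord0 i) +
      2^-1 * \sum_i (q ord0 i - p ord0 i).
    by rewrite !mulr_sumr -big_split/=; apply: eq_bigr => i _; lra.
  rewrite sumrB (sum_proj_closure Cp) (sum_proj_closure Dq) subrr mulr0 addr0.
  rewrite ler_wpM2l ?invr_ge0// /l1norm ler_sum// => i _.
  rewrite !mxE distrC (le_trans (ler_norm _))// normrM ler_piMl//.
  by rewrite ler_norml; have := c01 i; lra.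
have sumE : \sum_i c i * p ord0 i + \sum_i (1 - c i) * q ord0 i =
    1 - \sum_i c i * (q ord0 i - p ord0 i).
  rewrite -[in RHS](sum_proj_closure Dq) -sumrB -big_split/=.
  by apply: eq_bigr => i _; ring.
have := Pa _ Cp; have := Qb _ Dq; lra.
Qed.

End partition_tests.

Unset Implicit Arguments.

Theorem corollaryE1 (R : realType) (d : measure_display)
    (T : measurableType d) (P Q : set (probability T R))
    (P0 : P !=set0) (Q0 : Q !=set0) :
  [/\ (forall pi : fin_partition T,
         exists p q, [/\ proj_closure pi P p, proj_closure pi Q q &
           dTV (proj_closure pi P) (proj_closure pi Q) =
             (2^-1 * l1norm (p - q))%:E]),
      (1 - minimax_risk P Q)%E =
        ereal_sup [set dTV (proj_closure pi P) (proj_closure pi Q)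
                  | pi in [set: fin_partition T]],
      (forall eps : R, 0 <= eps ->
         (minimax_risk P Q < (1 - eps)%:E)%E <->
         exists pi : fin_partition T,
           (eps%:E < dTV (proj_closure pi P) (proj_closure pi Q))%E) &
      (forall eps : R, 0 <= eps ->
         forall pi : fin_partition T,
           (eps%:E < dTV (proj_closure pi P) (proj_closure pi Q))%E ->
           exists phi : T -> R,
             [/\ is_test phi,
                 (risk phi P Q < (1 - eps)%:E)%E &
                 forall i x y, block pi i x -> block pi i y ->
                   phi x = phi y])].
Proof.
(* Stated for [eps] of any sign, because it is applied below to a distance minus [e], which may be
   negative. *)
have test_of (eps : R) (pi : fin_partition T) :
    (eps%:E < dTV (proj_closure pi P) (proj_closure pi Q))%E ->
    exists phi : T -> R, [/\ is_test phi, (risk phi P Q < (1 - eps)%:E)%E &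
      forall i x y, block pi i x -> block pi i y -> phi x = phi y].
  have [p [q [Cp Dq dE]]] := dTV_attained pi P0 Q0.
  rewrite dE lte_fin => epsd.
  (* The midpoint of [eps] and the distance turns the non-strict risk bound into a strict one. *)
  have [|c [c01 rle]] := @exists_test_of_dTV R d T pi P Q
    (2^-1 * (eps + 2^-1 * l1norm (p - q))) P0 Q0.
    by rewrite dE lte_fin; lra.
  exists (step_fun c); split; first exact: is_test_step_fun.
    by apply: le_lt_trans rle _; rewrite lte_fin; lra.
  by move=> i x y xi yi; rewrite (step_funE _ xi) (step_funE _ yi).
have test0 : @is_test R d T (fun=> 0).
  by split; [exact: measurable_cst | move=> x; rewrite lexx ler01].
(* Risks are nonnegative and the zero test has finite risk; finiteness makes the subtraction from 1
   behave as in the reals. *)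
have minimax_fin : minimax_risk P Q \is a fin_num.
  rewrite ge0_fin_numE; last first.
    by apply: le_ereal_inf_tmp => _ [phi tphi <-]; exact: risk_ge0.
  apply: (@le_lt_trans _ _ (risk (fun=> 0) P Q)).
    by apply: ereal_inf_lbound; exists (fun=> 0).
  by rewrite -ge0_fin_numE ?risk_ge0// risk_fin_num.
have eq_sup : (1 - minimax_risk P Q)%E =
    ereal_sup [set dTV (proj_closure pi P) (proj_closure pi Q)
              | pi in [set: fin_partition T]].
  apply/eqP; rewrite eq_le; apply/andP; split.
    (* One half of [e] pays for a near-optimal test, the other for its step approximation. *)
    apply/lee_addgt0Pr => e e0; have e20 : 0 < 2^-1 * e by lra.
    have [_ [phi tphi <-] phi_lt] := lb_ereal_inf_adherent e20 minimax_fin.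
    have [pi pi_ge] := exists_partition_of_test P0 Q0 tphi e20.
    have [p [q [Cp Dq dE]]] := dTV_attained pi P0 Q0.
    apply: (@le_trans _ _ (dTV (proj_closure pi P) (proj_closure pi Q) + e%:E)%E).
      move: pi_ge phi_lt; rewrite dE -/(minimax_risk P Q) -(fineK minimax_fin).
      rewrite -(fineK (risk_fin_num P0 Q0 tphi)) -!EFinD.
      by rewrite !lee_fin !lte_fin; lra.
    by rewrite leeD2r//; apply: ereal_sup_ubound; exists pi.
  apply: ge_ereal_sup => _ [pi _ <-].
  have [p [q [Cp Dq dE]]] := dTV_attained pi P0 Q0.
  rewrite dE leeBrDr// -leeBrDl//.
  apply/lee_addgt0Pr => e e0.
  (* A threshold just below the distance gives a test of risk less than 1 minus the distance plus
     [e], for every [e > 0]. *)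
  have [|phi [tphi rlt _]] := test_of (2^-1 * l1norm (p - q) - e) pi.
    by rewrite dE lte_fin ltrBlDr ltrDl.
  apply: (@le_trans _ _ (risk phi P Q)).
    by apply: ereal_inf_lbound; exists phi.
  apply: le_trans (ltW rlt) _.
  by rewrite -EFinB -EFinD lee_fin; lra.
split.
- by move=> pi; exact: dTV_attained.
- exact: eq_sup.
- move=> eps eps0; split.
  + move=> risk_lt.
    have : (eps%:E < ereal_sup [set dTV (proj_closure pi P) (proj_closure pi Q)
              | pi in [set: fin_partition T]])%E.
      rewrite -eq_sup; move: risk_lt.
      rewrite -(fineK minimax_fin) -EFinB !lte_fin; lra.
    by move=> /ereal_sup_gt[_ [pi _ <-] h]; exists pi.
  + move=> [pi /test_of[phi [tphi rlt _]]].
    apply: le_lt_trans rlt.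
    by apply: ereal_inf_lbound; exists phi.
- by move=> eps _ pi; exact: test_of.
Qed.
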